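(* Let $D$ be a finite source-free bipartite digraph with bipartition $U\cup V$. If $q\ge 3$ is an odd integer and every directed cycle of $D$ has length at least $(q+3)/2$, then $D$ contains a $q$-kernel $Q$ with $|Q|\le\frac{2}{q+3}|V(D)|$ and $Q\subseteq U$.
   Context: A digraph is source-free if every vertex has in-degree at least $1$. A partition $U,V$ of $V(D)$ is a bipartition if every arc has exactly one endpoint in $U$ and one in $V$. A set is independent if there are no arcs between two of its vertices. $\mathrm{dist}(S,v)$ is the minimum over $u\in S$ of the length of a shortest directed path from $u$ to $v$. A $q$-kernel is an independent set $Q$ with $\mathrm{dist}(Q,v)\le q$ for all $v\in V(D)$. *)

(* Defs.v *)
From HB Require Import structures.
From mathcomp Require Import all_boot all_order all_algebra.

Set Implicit Arguments.
Unset Strict Implicit.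
Unset Printing Implicit Defensive.

(* Distances take values in [option nat], with [None] as infinity;
   [omin] is the minimum on [option nat], with neutral element [None]. *)
Notation omin := (oAC minnA minnC).

Section Digraph.

(* A finite digraph: vertex set [T], with an arc from [x] to [y] iff [e x y].
   Antiparallel arcs are allowed; loops are excluded by [bipartition]. *)
Variables (T : finType) (e : rel T).

Definition indegree (v : T) : nat := #|[set u | e u v]|.

Definition source_free : Prop := forall v : T, 1 <= indegree v.

Definition bipartition (U V : {set T}) : Prop :=
  [/\ U :|: V = [set: T],
      [disjoint U & V]
    & forall x y : T, e x y ->
        (x \in U) && (y \in V) || (x \in V) && (y \in U)].

Definition independent (S : {set T}) : Prop :=
  forall x y : T, x \in S -> y \in S -> ~~ e x y.

(* The vertex sequence is [c]; its length (number of arcs) is [size c]. *)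
Definition dicycle (c : seq T) : Prop := c != [::] /\ ucycle e c.

(* The vertex sequence is [u :: p]; its length (number of arcs) is [size p]. *)
Definition dipath (u v : T) (p : seq T) : bool :=
  [&& path e u p, uniq (u :: p) & last u p == v].

Definition has_dipath (u v : T) (n : nat) : bool :=
  [exists p : n.-tuple T, dipath u v p].

(* Directed paths have length less than [#|T|]. *)
Definition dist (u v : T) : option nat :=
  \big[omin/None]_(n < #|T| | has_dipath u v n) Some (n : nat).

Definition dist_set (S : {set T}) (v : T) : option nat :=
  \big[omin/None]_(u in S) dist u v.

Definition ole (d : option nat) (q : nat) : bool :=
  if d is Some n then n <= q else false.

Definition qkernel (q : nat) (Q : {set T}) : Prop :=
  independent Q /\ forall v : T, ole (dist_set Q v) q.

Lemma ole_big (I : finType) (P : pred I) (F : I -> option nat) (q : nat) :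
  ole (\big[omin/None]_(i | P i) F i) q = [exists (i | P i), ole (F i) q].
Proof.
rewrite -big_orE; apply: (big_morph (fun d => ole d q)) => //.
by move=> [m|] [n|]; rewrite ?oACE /= ?orbF // geq_min.
Qed.

Lemma dist_setP (S : {set T}) (v : T) (q : nat) :
  reflect (exists u p, [/\ u \in S, dipath u v p & size p <= q])
          (ole (dist_set S v) q).
Proof.
rewrite /dist_set ole_big; apply: (iffP existsP) => [[u /andP[uS]]|].
  rewrite /dist ole_big => /existsP[n /andP[/existsP[p up] lenq]].
  by exists u, p; rewrite size_tuple.
move=> [u [p [uS up pq]]]; exists u; rewrite uS /= /dist ole_big.
have lt_p : size p < #|T|.
  by case/and3P: up => _ /card_uniqP eq_sz _; rewrite -[_.+1]eq_sz max_card.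
apply/existsP; exists (Ordinal lt_p); rewrite /= pq andbT.
by apply/existsP; exists (in_tuple p).
Qed.

End Digraph.

(* Main.v *)
(* Write q = 2k+1 and choose an in-neighbour f v of every vertex v. A subset of U
   is independent, so it is enough to find Q in U, of size at most n/(k+2), that
   every f-orbit meets within 2k+1 steps. Remove blocks one at a time.
   - A vertex x of U off the f-cycles, with a descendant at distance 2k and
     fewest descendants, covers all its descendants; there are at least
     2k+1 >= k+2 of them.
   - If there is no such x, consider the component of an f-cycle. When it is just
     the cycle, every (2k+2)-nd vertex will do, since the length is even and at
     least k+2. Otherwise open the cycle at a suitable vertex c of U: cutting the
     resulting tree as above gives s-1 parts of size at least 2k+1, and c covers
     the rest. If s = 1 the cycle already has k+2 vertices; if s > 1, three
     uncut vertices suffice because (2k+1)(s-1) + 3 >= (k+2)s. *)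
Require Import Defs.
From mathcomp Require Import all_boot all_order all_algebra.
From mathcomp Require Import zify.

Set Implicit Arguments.
Unset Strict Implicit.
Unset Printing Implicit Defensive.

Section Functional.

Variables (T : finType) (U : {set T}).
Implicit Types (f : T -> T) (S Q P : {set T}) (x y v c : T) (k q h : nat).

(** * Orbits of a self-map and cutting off one block *)

(** The orbit starts at [f x] because [fconnect f x x] always holds. *)
Definition periodic f x := fconnect f (f x) x.

Definition descendants f S x := [set v in S | fconnect f v x].

Definition tall f S h x := [exists v in S, iter h f v == x].

Definition stable f S := {in S, forall v, f v \in S}.

(** When [f] chooses in-neighbours, an orbit read backwards is a walk from [Q] to [v]. *)
Definition covers f q Q S :=
  {in S, forall v, exists2 i, i <= q & iter i f v \in Q}.

Lemma fconnect_iterP f x y :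
  reflect (exists i, iter i f x = y) (fconnect f x y).
Proof.
apply: (iffP idP) => [xy|[i <-]]; last exact: fconnect_iter.
by exists (findex f x y); apply: iter_findex.
Qed.

Lemma periodic_iter_eq f x n : 0 < n -> iter n f x = x -> periodic f x.
Proof.
by case: n => // n _ xE; apply/fconnect_iterP; exists n; rewrite -iterSr.
Qed.

Lemma periodic_f f x : periodic f x -> periodic f (f x).
Proof.
case/fconnect_iterP=> i ix; apply/fconnect_iterP; exists i.
by rewrite -iterSr iterS ix.
Qed.

Lemma periodic_iter f x n : periodic f x -> periodic f (iter n f x).
Proof. by move=> px; elim: n => //= n; apply: periodic_f. Qed.

Lemma periodic_connect f x y : periodic f x -> fconnect f x y -> periodic f y.
Proof. by move=> px /fconnect_iterP[i <-]; apply: periodic_iter. Qed.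

Lemma periodic_connect_sym f x y :
  periodic f x -> fconnect f x y -> fconnect f y x.
Proof.
move=> px /fconnect_iterP[i <-]; elim: i => [|i IH]; first exact: connect0.
by apply: connect_trans IH; apply: (periodic_iter i px).
Qed.

(** A repeated iterate is periodic, and then so are all later ones, including the [n]-th. *)
Lemma iter_inj_nonperiodic f y n : ~~ periodic f (iter n f y) ->
  {in [pred i | i <= n] &, injective (fun i => iter i f y)}.
Proof.
move=> npy a b; rewrite !inE; wlog ab : a b / a < b.
  move=> H an bn E; case: (ltngtP a b) => // ab; first exact: H.
  by apply/esym; apply: H.
move=> _ bn E; case/negP: npy.
have -> : n = (n - a) + a by lia.
rewrite iterD; apply: periodic_iter; apply: (@periodic_iter_eq _ _ (b - a)).
  by rewrite subn_gt0.
by rewrite -iterD subnK ?(ltnW ab).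
Qed.

Lemma stable_iter f S v n : stable f S -> v \in S -> iter n f v \in S.
Proof. by move=> Sf Sv; elim: n => //= n; apply: Sf. Qed.

Lemma descendantsS f S x : descendants f S x \subset S.
Proof. by apply/subsetP=> v; rewrite inE => /andP[]. Qed.

Lemma stableD f S x : stable f S -> stable f (S :\: descendants f S x).
Proof.
move=> Sf v; rewrite !inE => /andP[nx Sv]; rewrite Sf // andbT.
apply: contraNN nx => /=; rewrite Sv /= => /(connect_trans _); apply.
exact: fconnect1.
Qed.

Lemma tallS f S S' h x : S \subset S' -> tall f S h x -> tall f S' h x.
Proof.
move=> /subsetP SS' /existsP[v /andP[Sv vx]]; apply/existsP; exists v.
by rewrite SS'.
Qed.

Lemma coversU f q Q Q' S R : covers f q Q R -> covers f q Q' (S :\: R) ->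
  covers f q (Q :|: Q') S.
Proof.
move=> cR cSR v Sv; case: (boolP (v \in R)) => [/cR|vR].
  by case=> i iq H; exists i; rewrite // inE H.
by case: (cSR v) => [|i iq H]; [rewrite inE vR|exists i; rewrite // inE H orbT].
Qed.

(* Among the admissible [x], take one with fewest descendants. *)
Lemma cut_tall f S k x0 : stable f S ->
    {in S, forall v, ~~ periodic f v -> (f v \in U) = (v \notin U)} ->
    x0 \in U -> ~~ periodic f x0 -> tall f S k.*2 x0 ->
  exists x, [/\ x \in U, ~~ periodic f x, tall f S k.*2 x,
    covers f k.*2.+1 [set x] (descendants f S x)
    & k.*2.+1 <= #|descendants f S x| ].
Proof.
move=> Sf alt Ux0 nx0 tx0.
pose adm x := [&& x \in U, ~~ periodic f x & tall f S k.*2 x].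
have adm0 : adm x0 by apply/and3P.
case: (arg_minnP (fun x => #|descendants f S x|) adm0) => x /and3P[Ux nx tx] mx.
have nback i v : iter i f v = x -> forall j, j <= i -> ~~ periodic f (iter j f v).
  move=> ix j ji; apply: contraNN nx => pj.
  by rewrite -ix -(subnK ji) iterD; apply: periodic_iter.
exists x; split=> // [v|].
  rewrite inE => /andP[Sv /fconnect_iterP[i ix]].
  case: (leqP i k.*2.+1) => [ik|ki]; first by exists i; rewrite ?inE ?ix.
  (* The point two steps before [x] is in [U] by alternation and is reached from [v] after at least
     [2k] steps. So it is admissible, with fewer descendants than [x]. *)
  exfalso; set j := i - 2; have ij : i = j.+2 by lia.
  have Sj n : iter n f v \in S by apply: stable_iter.
  have nj : ~~ periodic f (iter j f v) by apply: (nback i) => //; clear - ij; lia.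
  have Uj : iter j f v \in U.
    have nj1 : ~~ periodic f (iter j.+1 f v) by apply: (nback i) => //; clear - ij; lia.
    have := alt _ (Sj j.+1) nj1; rewrite -iterS -ij ix Ux => /esym.
    by rewrite (alt _ (Sj j) nj) negbK.
  have /mx : adm (iter j f v).
    rewrite /adm Uj nj; apply/existsP; exists (iter (j - k.*2) f v).
    rewrite Sj -iterD subnKC; [exact: eqxx|clear - ki ij; lia].
  rewrite leqNgt => /negP; apply; apply: proper_card; apply/properP; split.
    apply/subsetP=> w; rewrite !inE => /andP[-> /=] /connect_trans; apply.
    by rewrite -ix ij -addn2 addnC iterD; apply: fconnect_iter.
  exists x; rewrite !inE.
    by rewrite connect0 -ix Sj.
  rewrite negb_and; apply/orP; right; apply: contraNN nx => /fconnect_iterP[m mx'].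
  apply: (@periodic_iter_eq _ _ (2 + m)) => //.
  by rewrite iterD mx' -iterD -[in RHS]ix ij.
case/existsP: tx => v /andP[Sv /eqP vx].
(* The path from [v] to [x] supplies [2k+1] distinct descendants. *)
have un : uniq [seq iter i f v | i <- iota 0 k.*2.+1].
  rewrite map_inj_in_uniq ?iota_uniq // => a b; rewrite !mem_iota /= => ha hb.
  by apply: (iter_inj_nonperiodic (n := k.*2)); rewrite ?vx // inE; lia.
have <- : size [seq iter i f v | i <- iota 0 k.*2.+1] = k.*2.+1.
  by rewrite size_map size_iota.
rewrite cardE; apply: uniq_leq_size => // w /mapP[i]; rewrite mem_iota => hi ->.
rewrite mem_enum inE stable_iter //=; apply/fconnect_iterP; exists (k.*2 - i).
by rewrite -iterD subnK //; lia.
Qed.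

(** * Trees with a fixed point as root *)

(** Subtrees are cut off until the root [c] covers the rest. Each cut takes at least [2k+1] vertices
    and spares [P], whose members meet no tall vertex of [U] before [c]. Alternation cannot hold at
    [c], which [f] fixes. *)
Lemma tree_cover f S P c k : f c = c -> c \in U -> stable f S -> c \in S ->
    {in S, forall v, fconnect f v c} ->
    {in S, forall v, v != c -> (f v \in U) = (v \notin U)} ->
    P \subset S ->
    (forall p x, p \in P -> fconnect f p x -> x \in U -> x != c ->
       ~~ tall f S k.*2 x) ->
  exists Q, [/\ Q \subset S :&: U, covers f k.*2.+1 Q S, 0 < #|Q|
    & k.*2.+1 * (#|Q| - 1) + #|P| <= #|S| ].
Proof.
move=> fc Uc; have [n] := ubnP #|S|; elim: n S => // n IH S ltS Sf Sc toc alt PS Pt.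
have perE v : v \in S -> periodic f v = (v == c).
  move=> Sv; apply/idP/eqP => [pv|->]; last by rewrite /periodic fc connect0.
  have /fconnect_iterP[i <-] := periodic_connect_sym pv (toc _ Sv).
  by elim: i => //= i ->.
have [x0|no] := pickP [pred x | [&& x \in U, x != c & tall f S k.*2 x]]; last first.
  exists [set c]; rewrite cards1 subnn muln0 subset_leq_card // sub1set inE Sc Uc.
  split=> // v Sv; have vc := toc _ Sv; set i := findex f v c.
  have ic : iter i f v = c by apply: iter_findex.
  exists i; last by rewrite ic inE.
  (* [findex] is the first arrival at [c], so no earlier iterate equals [c]. *)
  have lti : i < order f v by apply: findex_max.
  have nc j : j < i -> iter j f v != c.
    move=> ji; apply/eqP => jc; have := findex_iter (ltn_trans ji lti).
    by rewrite jc -/i => E; rewrite E ltnn in ji.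
  (* Otherwise the vertex two steps before [c] would be a tall vertex of [U]. *)
  rewrite leqNgt; apply/negP => ki; set j := i - 2; have ij : i = j.+2 by lia.
  have Sj m : iter m f v \in S by apply: stable_iter.
  have Uj : iter j f v \in U.
    have [nj nj1] : iter j f v != c /\ iter j.+1 f v != c by split; apply: nc; lia.
    have := alt _ (Sj j.+1) nj1; rewrite -iterS -ij ic Uc => /esym.
    by rewrite (alt _ (Sj j) nj) negbK.
  move: (no (iter j f v)); rewrite /= Uj nc; last by lia.
  move/existsP; apply; exists (iter (j - k.*2) f v).
  rewrite Sj -iterD subnKC; [exact: eqxx|clear - ki ij; lia].
move=> /and3P[Ux0 x0c tx0].
have Sx x : tall f S k.*2 x -> x \in S.
  by case/existsP=> v /andP[Sv /eqP<-]; apply: stable_iter.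
have [||x [Ux nx tx cx kx]] := cut_tall Sf _ Ux0 _ tx0.
- by move=> v Sv; rewrite perE //; apply: alt.
- by rewrite perE // Sx.
set R := descendants f S x in cx kx.
have xc : x != c by rewrite -perE // Sx.
have RS : R \subset S by apply: descendantsS.
have cR : #|S :\: R| = #|S| - #|R| by rewrite cardsD (setIidPr RS).
have lRS := subset_leq_card RS.
have SRS : S :\: R \subset S by apply: subsetDl.
have [|||||||Q [QS cQ Q0 kQ]] := IH (S :\: R).
- by clear - cR lRS kx ltS; lia.
- exact: stableD.
- rewrite !inE Sc andbT /=; apply/fconnect_iterP => -[i].
  have -> : iter i f c = c by elim: i => //= i ->.
  by move=> /eqP; rewrite eq_sym (negPf xc).
- by move=> v /(subsetP SRS); apply: toc.
- by move=> v /(subsetP SRS); apply: alt.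
- apply/subsetP=> p Pp; rewrite inE (subsetP PS) // andbT inE (subsetP PS) //=.
  by apply/negP => /(Pt p x Pp) /(_ Ux xc); rewrite tx.
- move=> p y Pp py Uy yc; apply: contraNN (Pt p y Pp py Uy yc); exact: tallS.
exists ([set x] :|: Q).
have xQ : x \notin Q.
  apply/negP => /(subsetP QS); rewrite !inE connect0 (Sx _ tx) //.
split.
- rewrite subUset sub1set inE Ux Sx //=; apply: subset_trans QS _.
  exact: setSI.
- exact: coversU cx cQ.
- by rewrite cardsU1 xQ.
- by rewrite cardsU1 xQ; clear - cR lRS kx kQ Q0; nia.
Qed.

(** * Periodic points and a single cycle *)

(** Pigeonhole: otherwise [#|T|.+1] iterates would be distinct. *)
Lemma periodic_large_iter f v : periodic f (iter #|T| f v).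
Proof.
apply/negPn/negP => /iter_inj_nonperiodic inj.
have un : uniq [seq iter i f v | i <- iota 0 #|T|.+1].
  rewrite map_inj_in_uniq ?iota_uniq // => a b; rewrite !mem_iota /= => ha hb.
  by apply: inj; [exact: ha|exact: hb].
have := max_card (mem [seq iter i f v | i <- iota 0 #|T|.+1]).
by rewrite (card_uniqP un) size_map size_iota ltnn.
Qed.

Lemma iter_alternate f v n : (forall x, (f x \in U) = (x \notin U)) ->
  (iter n f v \in U) = (v \in U) (+) odd n.
Proof.
move=> alt; elim: n => [|n IH]; first by rewrite addbF.
by rewrite iterS alt IH /= addbN.
Qed.

Lemma cycle_cover f c k : 0 < k ->
    (forall v, (f v \in U) = (v \notin U)) ->
    periodic f c -> k.+2 <= order f c -> c \in U ->
  exists Q, [/\ Q \subset [set v in U | fconnect f c v],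
    covers f k.*2.+1 Q [set v | fconnect f c v] & k.+2 * #|Q| <= order f c].
Proof.
move=> k0 alt pc kc Uc; set L := order f c in kc *.
have cL : iter L f c = c by apply/(orbitPcycle 2 4).
have Lev : ~~ odd L by have := iter_alternate c L alt; rewrite cL Uc; case: odd.
(* Every [w]-th vertex is taken, starting at [c]: [d.+1] is [L / w] rounded up, and [w] is even to
   stay in [U]. *)
pose w := k.*2.+2; pose d := L.-1 %/ w.
have dL := divn_eq L.-1 w; have rL : L.-1 %% w < w by rewrite ltn_mod.
rewrite -/d in dL; move: (L.-1 %% w) dL rL => r dL rL.
exists [set iter (a * w) f c | a : 'I_d.+1]; split.
- apply/subsetP => _ /imsetP[a _ ->]; rewrite inE fconnect_iter iter_alternate //.
  by rewrite Uc oddM /= odd_double andbF.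
- move=> v; rewrite inE => cv; have := findex_max cv; have := iter_findex cv.
  rewrite -/L; move: (findex f c v) => p <- pL.
  (* Past the last chosen position the orbit returns to [c]; before it, the next multiple of [w] is
     hit. *)
  case: (leqP p (d * w)) => pd; last first.
    exists (L - p); first by rewrite /w in dL rL pd; lia.
    rewrite -iterD subnK ?(ltnW pL) // cL.
    by apply/imsetP; exists ord0.
  have pE := divn_eq p w; have rp : p %% w < w by rewrite ltn_mod.
  move: (p %/ w) (p %% w) pE rp => a b pE rp.
  case: (posnP b) => b0.
    exists 0 => //=; have ad : a < d.+1 by rewrite /w in pE pd; nia.
    by apply/imsetP; exists (Ordinal ad); rewrite // pE b0 addn0.
  exists (w - b); first by rewrite /w; lia.
  have ad : a.+1 < d.+1 by rewrite /w in pE pd; nia.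
  apply/imsetP; exists (Ordinal ad) => //; rewrite -iterD; congr (iter _ f c).
  by rewrite [RHS]mulSn; lia.
- apply: leq_trans (_ : k.+2 * d.+1 <= _).
    by rewrite leq_mul2l /= -[X in _ <= X]card_ord leq_imset_card.
  case: (posnP d) => d0; first by rewrite d0; lia.
  (* [r = 0] would make [L] odd. The resulting bound [L >= d * w + 2] is exactly what [d = 1]
     needs. *)
  have r0 : 0 < r.
    rewrite lt0n; apply: contraNneq Lev => r0.
    have -> : L = (d * w).+1 by lia.
    by rewrite /= oddM /= odd_double andbF.
  by rewrite /w in dL; nia.
Qed.

(** * Opening a cycle *)

Definition fix_at f c v := if v == c then c else f v.

(** An orbit of [fix_at f c] never leaves [c], so one that ends elsewhere has followed [f]
    throughout. *)
Lemma iter_fix_at f c x v i :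
  x != c -> iter i (fix_at f c) v = x -> iter i f v = x.
Proof.
elim: i x => // i IH x xc; rewrite !iterS {1}/fix_at.
case: eqP => [_ cx|/eqP ic <-]; first by rewrite cx eqxx in xc.
by rewrite (IH _ ic erefl).
Qed.

(** Dropping the steps spent waiting at [c] carries covers from [fix_at f c] back to [f] with the
    same bound. *)
Lemma iter_fix_at_le f c x v i :
  iter i (fix_at f c) v = x -> exists2 j, j <= i & iter j f v = x.
Proof.
elim: i v => [|i IH] v; first by exists 0.
rewrite iterSr {2}/fix_at; case: eqP => [->|_ /IH[j ji jx]].
  move=> <-; exists 0 => //=; elim: i {IH} => //= i <-.
  by rewrite /fix_at eqxx.
by exists j.+1; rewrite ?iterSr.
Qed.

Lemma fconnect_fix_at f c v : fconnect f v c -> fconnect (fix_at f c) v c.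
Proof.
case/fconnect_iterP=> i; elim: i v => [|i IH] v; first by move=> /= ->; apply: connect0.
rewrite iterSr; have [-> _|vc /IH] := eqVneq v c; first exact: connect0.
apply: connect_trans; rewrite -[f v](_ : fix_at f c v = _) ?fconnect1 //.
by rewrite /fix_at (negPf vc).
Qed.

(* Opening the cycle at [c] leaves a tree. The vertices [c], [z] and [y] lie
   outside every subtree that gets cut off, and they are exactly what is needed
   to pay for the last vertex of [Q], which is [c]. *)
Lemma unicyclic_cover f S k c z y : 0 < k ->
    (forall v, (f v \in U) = (v \notin U)) -> stable f S ->
    (forall x, x \in U -> ~~ periodic f x -> ~~ tall f S k.*2 x) ->
    periodic f c -> k.+2 <= order f c -> c \in U -> c \in S ->
    periodic f z -> f z = c -> z \in S ->
    ~~ periodic f y -> (f y == c) || (f y == z) -> y \in S ->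
  exists Q, [/\ Q \subset descendants f S c :&: U,
    covers f k.*2.+1 Q (descendants f S c)
    & k.+2 * #|Q| <= #|descendants f S c| ].
Proof.
move=> k0 alt Sf low pc kc Uc Sc pz fz Sz npy fy Sy.
set g := fix_at f c; set R := descendants f S c.
have zU : z \notin U by rewrite -alt fz.
have zc : z != c by apply: contraNneq zU => ->.
have yc : y != c by apply: contraNneq npy => ->.
have yz : y != z by apply: contraNneq npy => ->.
have gc : g c = c by rewrite /g /fix_at eqxx.
have gE v : v != c -> g v = f v by rewrite /g /fix_at => /negPf->.
have itc i : iter i g c = c by elim: i => //= i ->.
have zR : fconnect f z c by rewrite -fz fconnect1.
have yR : fconnect f y c.
  by apply: connect_trans (fconnect1 f y) _; case/orP: fy => /eqP-> //; apply: connect0.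
have [||||||Q [QS cQ Q0 kQ]] := @tree_cover g R [set c; z; y] c k gc Uc.
- move=> v; rewrite !inE => /andP[Sv]; case: (eqVneq v c) => [-> _|vc].
    by rewrite gc Sc connect0.
  rewrite gE // Sf //= => /fconnect_iterP[[|i]] /=.
    by move=> /eqP; rewrite (negPf vc).
  by rewrite -iterS iterSr => <-; apply: fconnect_iter.
- by rewrite inE Sc connect0.
- by move=> v; rewrite inE => /andP[_]; apply: fconnect_fix_at.
- by move=> v _ vc; rewrite gE.
- apply/subsetP => v; rewrite !inE => /orP[/orP[]|] /eqP ->.
  + by rewrite Sc connect0.
  + by rewrite Sz.
  + by rewrite Sy.
- move=> p x Pp /fconnect_iterP[i ix] Ux xc.
  (* On the opened orbits of [c], [z] and [y], only [y] can lie in [U] and differ from [c]; [low]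
     then shows that it is not tall. *)
  have: x = y.
    move: Pp ix; rewrite !inE => /orP[/orP[]|] /eqP ->.
    + by rewrite itc => cx; rewrite cx eqxx in xc.
    + case: i => [/= zx|i]; first by rewrite zx Ux in zU.
      by rewrite iterSr gE // fz itc => cx; rewrite cx eqxx in xc.
    + case: i => // i; rewrite iterSr gE //; case/orP: fy => /eqP->.
        by rewrite itc => cx; rewrite cx eqxx in xc.
      case: i => [/= zx|i]; first by rewrite zx Ux in zU.
      by rewrite iterSr gE // fz itc => cx; rewrite cx eqxx in xc.
  move=> xy; rewrite {}xy in ix Ux xc *; apply: contraNN (low y Ux npy).
  case/existsP=> v /andP[]; rewrite inE => /andP[Sv _] /eqP /(iter_fix_at yc) vy.
  by apply/existsP; exists v; rewrite Sv vy /=.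
exists Q; split=> //.
  move=> v /cQ[i ik Qi]; have [j ji jE] := @iter_fix_at_le f c _ v i erefl.
  by exists j; [apply: leq_trans ik|rewrite jE].
have cP : #|[set c; z; y]| = 3.
  by rewrite setUC cardsU1 cards2 !inE negb_or yc yz eq_sym zc.
(* The whole cycle of [c] lies in [R], which settles [#|Q| = 1]. *)
have cR : k.+2 <= #|R|.
  apply: leq_trans kc _; apply: subset_leq_card; apply/subsetP => v cv.
  rewrite inE (periodic_connect_sym pc cv) andbT.
  by case/fconnect_iterP: cv => i <-; apply: stable_iter.
rewrite {}cP in kQ; case: (#|Q|) Q0 kQ => // -[_ _|s _]; first by rewrite muln1.
(* For [#|Q| = s.+2] the slack is [(k - 1) * s]. *)
by rewrite subn1 /=; clear - k0; nia.
Qed.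

(** * Finding a block and removing blocks one by one *)

Lemma stable_block f S k : 0 < k ->
    (forall v, (f v \in U) = (v \notin U)) ->
    (forall x, periodic f x -> k.+2 <= order f x) ->
    stable f S -> S != set0 ->
  exists c Q, [/\ c \in S, Q \subset descendants f S c :&: U,
    covers f k.*2.+1 Q (descendants f S c)
    & k.+2 * #|Q| <= #|descendants f S c| ].
Proof.
move=> k0 alt cyc Sf /set0Pn[u Su].
have [x /and3P[Ux nx tx]|low] :=
    pickP [pred x | [&& x \in U, ~~ periodic f x & tall f S k.*2 x]].
  have [|{Ux nx tx}x [Ux nx tx cx kx]] := cut_tall Sf _ Ux nx tx; first by move=> v _ _.
  have Sx : x \in S by case/existsP: tx => v /andP[Sv /eqP<-]; apply: stable_iter.
  exists x, [set x]; rewrite cards1 muln1; split=> //; last by lia.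
  by rewrite sub1set !inE Sx Ux connect0.
have {}low x : x \in U -> ~~ periodic f x -> ~~ tall f S k.*2 x.
  by move=> Ux nx; apply/negP => tx; have := low x; rewrite /= Ux nx tx.
have [y /and3P[Sy ny py]|allp] :=
    pickP [pred v | [&& v \in S, ~~ periodic f v & periodic f (f v)]].
  (* The cycle is opened at whichever of [f y] and [f (f y)] is in [U]; [z] is the predecessor of
     that vertex on the cycle. *)
  case: (boolP (f y \in U)) => Ufy.
    have [i] := fconnect_iterP f _ _ py; rewrite -iterSr iterS => iy.
    have Sz : iter i f (f y) \in S by apply: stable_iter => //; apply: Sf.
    have [Q HQ] := @unicyclic_cover f S k (f y) (iter i f (f y)) y k0 alt Sf low
      py (cyc _ py) Ufy (Sf _ Sy) (periodic_iter i py) iy Sz ny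
      (introT orP (or_introl (eqxx _))) Sy.
    by exists (f y), Q; case: HQ; split=> //; apply: Sf.
  have Uffy : f (f y) \in U by rewrite alt.
  have [Q HQ] := @unicyclic_cover f S k (f (f y)) (f y) y k0 alt Sf low
      (periodic_f py) (cyc _ (periodic_f py)) Uffy (Sf _ (Sf _ Sy)) py erefl
      (Sf _ Sy) ny (introT orP (or_intror (eqxx _))) Sy.
  by exists (f (f y)), Q; case: HQ; split=> //; exact/Sf/Sf.
(* As no nonperiodic point of [S] enters a cycle, periodicity passes back from a late iterate to
   [v]. *)
have Sp v : v \in S -> periodic f v.
  move=> Sv; have := periodic_large_iter f v; elim: #|T| => // n IH pn.
  apply: IH; apply/negPn/negP => npn.
  by have := allp (iter n f v); rewrite /= npn stable_iter // pn.
have [c Sc Uc] : exists2 c, c \in S & c \in U.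
  case: (boolP (u \in U)) => Uu; first by exists u.
  by exists (f u); rewrite ?alt ?Sf.
have [Q [QU cQ kQ]] := cycle_cover k0 alt (Sp _ Sc) (cyc _ (Sp _ Sc)) Uc.
have RE : descendants f S c = [set v | fconnect f c v].
  apply/setP => v; rewrite !inE; apply/andP/idP => [[Sv]|cv].
    by apply: periodic_connect_sym; apply: Sp.
  split; last by apply: periodic_connect_sym cv; apply: Sp.
  by case/fconnect_iterP: cv => i <-; apply: stable_iter.
exists c, Q; rewrite RE; split=> //.
  by apply: subset_trans QU _; apply/subsetP => v; rewrite !inE andbC.
by rewrite cardsE.
Qed.

(** What remains after removing a block is stable, and the ratio [k+2] adds up over disjoint
    blocks. *)
Lemma functional_cover f S k : 0 < k ->
    (forall v, (f v \in U) = (v \notin U)) ->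
    (forall x, periodic f x -> k.+2 <= order f x) -> stable f S ->
  exists Q, [/\ Q \subset U, covers f k.*2.+1 Q S & k.+2 * #|Q| <= #|S| ].
Proof.
move=> k0 alt cyc; have [n] := ubnP #|S|; elim: n S => // n IH S ltS Sf.
have [->|S0] := eqVneq S set0.
  by exists set0; rewrite sub0set !cards0 muln0; split=> // v; rewrite inE.
have [c [Q [Sc QR cQ kQ]]] := stable_block k0 alt cyc Sf S0.
set R := descendants f S c in QR cQ kQ.
have RS : R \subset S by apply: descendantsS.
have cR : #|S :\: R| = #|S| - #|R| by rewrite cardsD (setIidPr RS).
have lRS := subset_leq_card RS.
have R0 : 0 < #|R| by apply/card_gt0P; exists c; rewrite inE Sc connect0.
have [||Q' [QU' cQ' kQ']] := IH (S :\: R); [clear - cR lRS R0 ltS; lia|exact: stableD|].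
exists (Q :|: Q'); split.
- rewrite subUset QU' andbT; apply: subset_trans QR _; exact: subsetIr.
- exact: coversU cQ cQ'.
- apply: leq_trans (_ : k.+2 * (#|Q| + #|Q'|) <= _).
    by rewrite leq_mul2l leq_card_setU orbT.
  by rewrite mulnDr; clear - cR lRS kQ kQ'; lia.
Qed.

End Functional.

(** * From the self-map back to the digraph *)

Lemma iter_walk (T : eqType) (e : rel T) (f : T -> T) (v : T) (i : nat) :
    (forall x, e (f x) x) ->
  exists p, [/\ path e (iter i f v) p, last (iter i f v) p = v & size p = i].
Proof.
move=> ef; elim: i => [|i [p [pp lp sp]]]; first by exists [::].
by exists (iter i f v :: p); rewrite /= ef pp lp sp.
Qed.

(** Arcs run from [f v] to [v], so the orbit has to be reversed. *)
Lemma periodic_dicycle (T : finType) (e : rel T) (f : T -> T) (x : T) :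
  (forall v, e (f v) v) -> periodic f x -> dicycle e (rev (orbit f x)).
Proof.
move=> ef px; split.
  by rewrite -size_eq0 size_rev size_orbit -lt0n order_gt0.
apply/andP; split; last by rewrite rev_uniq orbit_uniq.
rewrite rev_cycle; apply: sub_cycle (_ : fcycle f _); last exact/(orbitPcycle 2 0).
by move=> a b /= /eqP <-.
Qed.

Theorem theorem6p5 (T : finType) (e : rel T) (U V : {set T}) (q : nat)
    (hsf : source_free e) (hbip : bipartition e U V)
    (hq : 3 <= q) (hodd : odd q)
    (hcyc : forall c : seq T, dicycle e c -> (q + 3) %/ 2 <= size c) :
  exists Q : {set T},
    [/\ qkernel e q Q,
        (#|Q|%:R <= 2%:R / (q + 3)%:R * #|T|%:R :> rat)%R
      & Q \subset U].

Proof.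
case: hbip => UV /pred0P dUV arcs.
pose k := q./2.
have qE : q = k.*2.+1 by have := odd_double_half q; rewrite hodd; lia.
have q3 : (q + 3) %/ 2 = k.+2 by lia.
have k0 : 0 < k by lia.
have inU v : (v \in V) = (v \notin U).
  have := dUV v; have : v \in U :|: V by rewrite UV inE.
  by rewrite /= !inE; case: (v \in U); case: (v \in V).
(* Source-freeness supplies an in-neighbour, so the default [v] is never returned. *)
pose f v := odflt v [pick u | e u v].
have ef v : e (f v) v.
  rewrite /f; case: pickP => //= no; have := hsf v.
  by rewrite /indegree (eq_card0 (A := [set u | e u v])) // => u; rewrite inE no.
have indep x y : e x y -> (x \in U) = (y \notin U).
  by move/arcs; rewrite !inU; case: (x \in U); case: (y \in U).
have alt v : (f v \in U) = (v \notin U) by apply: indep.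
have cyc x : periodic f x -> k.+2 <= order f x.
  by move=> /(periodic_dicycle ef) /hcyc; rewrite q3 size_rev size_orbit.
have [|Q [QU cQ kQ]] := @functional_cover T U f [set: T] k k0 alt cyc.
  by move=> v _; rewrite inE.
rewrite -qE in cQ; exists Q; split=> //.
- split=> [x y /(subsetP QU) Ux /(subsetP QU) Uy|v].
    by apply/negP => /indep; rewrite Ux Uy.
  apply/dist_setP; have [|i iq Qi] := cQ v; first by rewrite inE.
  have [p [pp lp sp]] := iter_walk v i ef.
  (* Distances count paths; shortening the walk to a path does not increase its length. *)
  move: lp; case: (shortenP pp) => p' pp' up' sub lp.
  exists (iter i f v), p'; split=> //; first by rewrite /dipath pp' up' lp /=.
  apply: leq_trans iq; rewrite -sp; apply: uniq_leq_size => //.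
  by case/andP: up'.
- rewrite cardsT in kQ.
  have q0 : (0 < (q + 3)%:R :> rat)%R by rewrite Num.Theory.ltr0n addn3.
  rewrite GRing.mulrAC Num.Theory.ler_pdivlMr // -!GRing.natrM Num.Theory.ler_nat.
  (* Here [q + 3 = 2 * (k + 2)]. *)
  by rewrite qE; nia.
Qed.
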